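(* For integers $n>3$ and $1\le k<n$, the $k$-derangement graph $\Gamma_{k,n}$ is Eulerian if and only if $k$ is even, or $k$ and $n$ are both odd.
   Context: $S_n$ is the symmetric group on $[n]=\{1,\dots,n\}$. For $\sigma\in S_n$, $\sigma_{(k)}$ denotes the induced permutation of the set of $k$-element subsets of $[n]$, $\sigma_{(k)}(\{a_1,\dots,a_k\})=\{\sigma(a_1),\dots,\sigma(a_k)\}$; $\sigma$ is a $k$-derangement if $\sigma_{(k)}$ fixes no $k$-element subset. Let $\mathcal{D}_{k,n}$ be the set of $k$-derangements in $S_n$. The $k$-derangement graph $\Gamma_{k,n}$ is the Cayley graph $\Gamma(S_n,\mathcal{D}_{k,n})$: vertices are the elements of $S_n$, and $u,v$ are adjacent iff $su=v$ for some $s\in\mathcal{D}_{k,n}$. A graph is Eulerian if it is connected and every vertex has even degree. *)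

(* Defs.v *)
From mathcomp Require Import all_boot all_fingroup.

Set Implicit Arguments.
Unset Strict Implicit.
Unset Printing Implicit Defensive.

Import GroupScope.

Section Graph.
Variable T : finType.

(* A simple graph on T is a symmetric irreflexive relation [e : rel T]; for such
   an [e], [connect e u v] says that some path joins u to v. *)
Definition neighbours (e : rel T) (u : T) : {set T} := [set v | e u v].

Definition degree (e : rel T) (u : T) : nat := #|neighbours e u|.

Definition connected_graph (e : rel T) : Prop := forall u v, connect e u v.

Definition eulerian (e : rel T) : Prop :=
  connected_graph e /\ forall u, ~~ odd (degree e u).

End Graph.

Definition cayley_graph (gT : finGroupType) (S : {set gT}) : rel gT :=
  fun u v => [exists s in S, s * u == v].

Section KDerangement.
Variables (k n : nat).

Definition ksubset : finType := {A : {set 'I_n} | #|A| == k}.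

Lemma card_imset_ksubset (s : 'S_n) (A : ksubset) : #|s @: val A| == k.
Proof. by rewrite (card_imset _ perm_inj) (valP A). Qed.

Definition induced_fun (s : 'S_n) (A : ksubset) : ksubset :=
  Sub (s @: val A) (card_imset_ksubset s A).

Lemma induced_fun_inj (s : 'S_n) : injective (induced_fun s).
Proof.
by move=> A B /(congr1 val) /= /(imset_inj (@perm_inj _ s)) /val_inj.
Qed.

Definition induced_perm (s : 'S_n) : {perm ksubset} := perm (@induced_fun_inj s).

Definition kderangement (s : 'S_n) : bool :=
  [forall A : ksubset, induced_perm s A != A].

Definition kderangements : {set 'S_n} := [set s | kderangement s].

(* The product of 'S_n composes from left to right: (s * u) x = u (s x). As
   [kderangements] is invariant under conjugation, composing from right to left
   gives the same graph. *)
Definition kderangement_graph : rel 'S_n := cayley_graph kderangements.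

Lemma kderangementP (s : 'S_n) :
  reflect (forall A : {set 'I_n}, #|A| = k -> s @: A <> A) (kderangement s).
Proof.
apply: (iffP forallP) => [H A /eqP cA sA | H A].
  by move/eqP: (H (Sub A cA)); apply; apply: val_inj; rewrite permE.
apply/eqP => /(congr1 val); rewrite permE /=.
exact: (H _ (eqP (valP A))).
Qed.

Lemma kderangementV (s : 'S_n) : kderangement s -> kderangement s^-1.
Proof.
move/kderangementP => H; apply/kderangementP => A cA sA; apply: (H A cA).
rewrite -{1}sA -imset_comp -[RHS]imset_id.
by apply: eq_imset => x /=; rewrite permKV.
Qed.

Lemma kderangementJ (s t : 'S_n) : kderangement s -> kderangement (s ^ t).
Proof.
move/kderangementP => H; apply/kderangementP => A cA sA.
apply: (H (t^-1 @: A)); first by rewrite (card_imset _ perm_inj).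
rewrite -{2}sA -!imset_comp.
by apply: eq_imset => x /=; rewrite conjgE !permM permK.
Qed.

Lemma kderangement_graph_sym : symmetric kderangement_graph.
Proof.
suff H u v : kderangement_graph u v -> kderangement_graph v u.
  by move=> u v; apply/idP/idP; apply: H.
case/existsP => s /andP[]; rewrite inE => Ds /eqP <-.
by apply/existsP; exists s^-1; rewrite inE kderangementV //= mulKg.
Qed.

Lemma kderangement_graph_irrefl : k <= n -> irreflexive kderangement_graph.
Proof.
move=> le_kn u; apply/existsP => -[s /andP[]].
rewrite inE -{2}[u]mul1g (inj_eq (mulIg u)) => /kderangementP Ds /eqP s1.
have [A cA] : exists A : {set 'I_n}, #|A| = k.
  exists [set widen_ord le_kn i | i : 'I_k].
  rewrite card_imset ?card_ord // => i j /(congr1 val) /= ij; exact: val_inj.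
apply: (Ds A cA); rewrite s1 -[RHS]imset_id.
by apply: eq_imset => x; rewrite perm1.
Qed.

End KDerangement.

Arguments kderangement k {n} s.
Arguments kderangements k n : clear implicits.
Arguments kderangement_graph k n : clear implicits.

(* Main.v *)
Require Import Defs.
From mathcomp Require Import all_boot all_fingroup.
From mathcomp Require Import zify.

(** The graph is regular of degree the number of [k]-derangements.  Inversion
    preserves this set, so modulo 2 only the [k]-deranging involutions count.
    An involution leaves invariant a set of every even size, and of every odd
    size as soon as it has a fixed point; hence there are none of them unless
    [k] is odd and [n] is even, in which case they are exactly the
    fixed-point-free involutions, whose number is odd.

    The graph is connected for all [n > 3].  If [c] is an [n]-cycle and
    [0 < p < n], then [c * (0 p)] has two cycles, of lengths [p] and [n - p].
    For [p] in [{1, 2}] outside [{k, n - k}] both permutations are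
    [k]-derangements, so the subgroup generated by the [k]-derangements contains
    a transposition, hence all of them since it is normal. *)

Set Implicit Arguments.
Unset Strict Implicit.
Unset Printing Implicit Defensive.

Import GroupScope.

(** The moved points split into those whose enumeration rank [f] raises and those whose rank it
    lowers; [f] exchanges the two classes, so their total is even. *)
Lemma odd_card_fixed (T : finType) (S : {set T}) (f : T -> T) :
    {in S, forall x, f x \in S} -> {in S, forall x, f (f x) = x} ->
  odd #|S| = odd #|[set x in S | f x == x]|.
Proof.
move=> fS fK; pose rk (x : T) := nat_of_ord (enum_rank x).
have rk_inj : injective rk by move=> x y /val_inj /enum_rank_inj.
pose L := [set x in S | rk x < rk (f x)].
pose G := [set x in S | rk (f x) < rk x].
have fLG : f @: L = G.
  apply/setP=> y; apply/imsetP/idP => [[x] | ].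
    by rewrite !inE => /andP[xS lt] ->; rewrite fS // fK.
  rewrite inE => /andP[yS lt]; exists (f y); last by rewrite fK.
  by rewrite inE fS // fK.
have cardLG : #|G| = #|L|.
  rewrite -fLG card_in_imset // => x y; rewrite !inE => /andP[xS _] /andP[yS _].
  by move=> fxy; rewrite -[x]fK // -[y]fK // fxy.
have moved : S :\: [set x in S | f x == x] = L :|: G.
  apply/setP=> x; rewrite !inE; case: (x \in S) => //=.
  by rewrite andbT -neq_ltn eq_sym (inj_eq rk_inj).
rewrite -(cardsID [set x in S | f x == x] S) moved cardsU cardLG.
have -> : S :&: [set x in S | f x == x] = [set x in S | f x == x].
  by apply/setP=> x; rewrite !inE andbA andbb.
have -> : L :&: G = set0.
  apply/setP=> x; rewrite !inE; case: (x \in S) => //=.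
  by case: ltngtP.
by rewrite cards0 subn0 addnn oddD odd_double addbF.
Qed.

(** * Invariant sets of involutions, and fixed-point-free involutions *)

Section Involutions.
Variable T : finType.
Implicit Types (A : {set T}) (s r : {perm T}).

Lemma imset_perm_eq s A : {in A, forall x, s x \in A} -> s @: A = A.
Proof.
move=> sA; apply/eqP; rewrite eqEcard (card_imset _ perm_inj) leqnn andbT.
by apply/subsetP=> _ /imsetP[x xA ->]; apply: sA.
Qed.

(** The set grows by two points at a time: of two points outside it, either one is moved by [s] and
    is added with its image, or both are fixed and are added together. *)
Lemma involution_invariant_set s A m :
    involutive s -> s @: A = A -> ~~ odd m -> #|A| + m <= #|T| ->
  exists2 B : {set T}, #|B| = #|A| + m & s @: B = B.
Proof.
move=> sK sA; rewrite -[m in ~~ odd m]odd_double_half => even_m.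
have -> : m = m./2.*2 by move: even_m; rewrite odd_double_half; lia.
elim: m./2 => [|j IH] le_jT; first by exists A; rewrite ?double0 ?addn0.
have [|B cardB sB] := IH; first by move: le_jT; rewrite doubleS; lia.
have addpair x y : x \notin B -> y \notin B -> x != y ->
    s x \in [set x; y] -> s y \in [set x; y] ->
  exists2 C : {set T}, #|C| = #|A| + j.+1.*2 & s @: C = C.
- move=> xB yB xy sx sy; exists ([set x; y] :|: B).
    rewrite -setUA !cardsU1 !inE (negPf xB) (negPf yB) (negPf xy) cardB.
    by rewrite doubleS; lia.
  apply: imset_perm_eq => z; rewrite !in_setU !in_set1 => /orP[/orP[]/eqP-> | zB].
  + by rewrite -in_set2 sx.
  + by rewrite -in_set2 sy.
  + by rewrite -sB imset_f ?orbT.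
have sBC x : x \notin B -> s x \notin B.
  by apply: contra => sxB; rewrite -[x]sK -sB imset_f.
have cardCB : 1 < #|~: B| by rewrite cardsCs setCK; move: le_jT; rewrite doubleS; lia.
have /card_gt1P[x [y [xB yB xy]]] := cardCB; rewrite !inE in xB yB.
have [sx|sx] := eqVneq (s x) x; last first.
  by apply: (addpair x (s x)); rewrite ?sBC ?sK ?set21 ?set22 // eq_sym.
have [sy|sy] := eqVneq (s y) y; last first.
  by apply: (addpair y (s y)); rewrite ?sBC ?sK ?set21 ?set22 // eq_sym.
by apply: (addpair x y); rewrite ?sx ?sy ?set21 ?set22.
Qed.

Definition fpf_involution s := [forall x, (s (s x) == x) && (s x != x)].

Lemma fpf_involutionP s :
  reflect (involutive s /\ forall x, s x != x) (fpf_involution s).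
Proof.
apply: (iffP forallP) => [H | [sK sx] x]; last by rewrite sK eqxx sx.
by split=> x; case/andP: (H x) => [/eqP].
Qed.

(* Conjugation by the transposition [(x r(x))] acts on the fixed-point-free
   involutions which agree with [r] on [l]; its fixed points are those which
   moreover agree with [r] at [x]. *)
Lemma odd_card_fpf_involutions r :
  fpf_involution r -> odd #|[set s | fpf_involution s]|.
Proof.
move=> /fpf_involutionP[rK rx].
(* [X] runs from [[set r]] at [enum T] to all fixed-point-free involutions at [[::]]; oddness is
   carried along as the points are dropped one by one. *)
pose X (l : seq T) := [set s | fpf_involution s & all (fun x => s x == r x) l].
have -> : [set s | fpf_involution s] = X [::].
  by apply/setP=> s; rewrite !inE andbT.
have X1 : odd #|X (enum T)|.
  suff -> : X (enum T) = [set r] by rewrite cards1.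
  apply/setP=> s; rewrite !inE; apply/andP/eqP => [[_ /allP sr] | ->].
    by apply/permP=> x; apply/eqP/sr; rewrite mem_enum.
  split; first by apply/fpf_involutionP.
  by apply/allP.
elim: (enum T) X1 => [|x l IH] // oddX; apply: IH.
pose t := tperm x (r x).
have tK y : t (t y) = y by rewrite tpermK.
have tr y : t (r y) = r (t y).
  rewrite /t; case: (tpermP x (r x) y) => [->|->|/eqP yx /eqP yrx].
  - by rewrite tpermR rK.
  - by rewrite rK tpermL.
  - by rewrite tpermD // eq_sym ?(inj_eq perm_inj) // -(inj_eq (@perm_inj _ r)) rK.
have conjE s y : (s ^ t) y = t (s (t y)).
  by rewrite conjgE tpermV !permM.
have agree s y : (s ^ t) y == r y = (s (t y) == r (t y)).
  by rewrite conjE -(inj_eq (@perm_inj _ t)) tK tr.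
(* If [t] moves [z], then [t z] is [r z], and involutions that agree at [z] also agree at [r z]. *)
have Xt s z : s \in X l -> z \in l -> s (t z) = r (t z).
  rewrite inE => /andP[/fpf_involutionP[sK _] /allP sr] zl.
  have /eqP sz := sr z zl; rewrite /t.
  case: tpermP => [zx|zx|_ _] //; last first.
    by apply: (@perm_inj _ s); rewrite sK -zx sz zx rK.
  by rewrite rK -zx -sz sK.
rewrite (@odd_card_fixed _ (X l) (conjg^~ t)) => [|s sX|s _].
- congr (odd _): oddX; apply: eq_card => s; rewrite !inE /= -andbA.
  case: fpf_involutionP => //= -[sK sx]; rewrite andbC; case: (all _ l) => //=.
  apply/eqP/eqP => [sxr | /permP/(_ x)].
    apply/permP=> y; rewrite conjE /t.
    case: (tpermP x (r x) y) => [->|->|/eqP yx /eqP yrx].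
    + by rewrite -sxr sK tpermL.
    + by rewrite sxr tpermR -sxr sK.
    + rewrite tpermD // eq_sym -?sxr ?(inj_eq perm_inj) //.
      by rewrite -(inj_eq (@perm_inj _ s)) sK sxr.
  (* This gives [s (r x) = t (s x)]. Were [s x] different from [r x], [t] would fix it, forcing
     [r x = x]. *)
  rewrite conjE /t tpermL => /(congr1 t); rewrite tK /t.
  case: tpermP => [/eqP|//|_ _ /perm_inj/eqP]; first by rewrite (negPf (sx x)).
  by rewrite (negPf (rx x)).
- have := sX; rewrite !inE => /andP[/fpf_involutionP[sK sx] _].
  apply/andP; split; last by apply/allP=> z zl; rewrite agree (Xt s).
  apply/fpf_involutionP; split=> y; rewrite !conjE ?tK ?sK ?tK //.
  by rewrite -{2}[y]tK (inj_eq perm_inj).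
- by rewrite -conjgM tperm2 conjg1.
Qed.
End Involutions.

(** * Degree and connectedness of Cayley graphs *)

Section CayleyGraphs.
Variables (gT : finGroupType) (S : {set gT}).

Lemma degree_cayley_graph u : degree (cayley_graph S) u = #|S|.
Proof.
rewrite /degree -(card_rcoset S u); apply: eq_card => v; rewrite !inE.
apply/existsP/rcosetP => [[s /andP[sS /eqP <-]] | [s sS ->]]; exists s => //.
by rewrite sS eqxx.
Qed.

(** The [g] for which every [u] is joined to [g * u] form a subgroup containing [S]. *)
Lemma connected_cayley_graph :
  <<S>> = [set: gT] -> connected_graph (cayley_graph S).
Proof.
move=> genS.
pose H := [set g | [forall u, connect (cayley_graph S) u (g * u)]].
have groupH : group_set H.
  apply/group_setP; split=> [|g h]; rewrite !inE.
    by apply/forallP=> u; rewrite mul1g.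
  move=> /forallP Hg /forallP Hh; apply/forallP=> u.
  by rewrite -mulgA; apply: connect_trans (Hh u) (Hg _).
have : <<S>> \subset Group groupH.
  rewrite gen_subG; apply/subsetP=> s sS; rewrite inE; apply/forallP=> u.
  by apply/connect1/existsP; exists s; rewrite sS eqxx.
rewrite genS => /subsetP sub u v.
have := sub (v * u^-1) (in_setT _); rewrite inE => /forallP/(_ u).
by rewrite mulgKV.
Qed.

End CayleyGraphs.

(** * Generation of the symmetric group by derangements of [k]-sets *)

Section Connectivity.
Variable n : nat.
Implicit Types (p i j : 'I_n.+1) (A : {set 'I_n.+1}).

Definition rotation : 'S_n.+1 := perm (@ordS_inj n.+1).

Definition split_rotation p : 'S_n.+1 := rotation * tperm ord0 p.

(** The orbits are the intervals from 0 to [p - 1] (empty if [p] is 0) and from [p] to [n], and an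
    invariant set is a union of orbits. *)
Lemma card_invariant_split_rotation p A :
  split_rotation p @: A = A -> #|A| \in [:: 0; nat_of_ord p; n.+1 - p; n.+1].
Proof.
set s := split_rotation p => sA.
have memS i : (s i \in A) = (i \in A).
  by rewrite -{1}sA mem_imset //; apply: perm_inj.
have step i j : j = i.+1 :> nat -> j != p -> (j \in A) = (i \in A).
  move=> ji jp; rewrite -(memS i) permM.
  have -> : rotation i = j.
    by apply: val_inj; rewrite permE /= -ji modn_small.
  by rewrite tpermD // eq_sym // -val_eqE /= ji.
have low i : i < p -> (i \in A) = (ord0 \in A).
  case: i => m mn /=; elim: m mn => [|m IH] mn mp.
    by congr (_ \in A); apply: val_inj.
  rewrite -(IH (ltnW mn) (ltnW mp)); apply: step => //.
  by rewrite -val_eqE /= neq_ltn mp.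
have high i : p <= i -> (i \in A) = (p \in A).
  case: i => m mn /=; elim: m mn => [|m IH] mn pm.
    by congr (_ \in A); apply: val_inj => /=; lia.
  have [mp|mp] := eqVneq m.+1 p; first by congr (_ \in A); apply: val_inj.
  rewrite -(IH (ltnW mn)); last by lia.
  exact: step.
have cardlow : #|[set i : 'I_n.+1 | i < p]| = p.
  have widen_inj : injective (widen_ord (ltnW (ltn_ord p))).
    by move=> i j /(congr1 val) /= ij; apply: val_inj.
  rewrite -[RHS]card_ord -(card_imset _ widen_inj); apply: eq_card => i.
  rewrite inE; apply/idP/imsetP => [ip | [j _ ->]] /=; last exact: ltn_ord.
  by exists (Ordinal ip) => //; apply: val_inj.
have memA i : (i \in A) = (if i < p then ord0 \in A else p \in A).
  by case: ltnP => [/low|/high].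
have [a0|a0] := boolP (ord0 \in A); have [ap|ap] := boolP (p \in A).
- suff -> : A = setT by rewrite cardsT card_ord !inE eqxx !orbT.
  by apply/setP=> i; rewrite memA a0 ap if_same inE.
- suff -> : A = [set i : 'I_n.+1 | i < p] by rewrite cardlow !inE eqxx orbT.
  by apply/setP=> i; rewrite memA a0 (negPf ap) inE; case: ltnP.
- suff -> : A = ~: [set i : 'I_n.+1 | i < p].
    by rewrite cardsCs setCK cardlow card_ord !inE eqxx !orbT.
  by apply/setP=> i; rewrite memA (negPf a0) ap !inE; case: ltnP.
- suff -> : A = set0 by rewrite cards0.
  by apply/setP=> i; rewrite memA (negPf a0) (negPf ap) if_same inE.
Qed.

Lemma kderangement_split_rotation k p :
  0 < k < n.+1 -> k != p -> k != n.+1 - p -> kderangement k (split_rotation p).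
Proof.
move=> /andP[k0 kn] kp knp; apply/kderangementP=> A cA.
move=> /card_invariant_split_rotation; rewrite cA !inE (negPf kp) (negPf knp).
by rewrite gtn_eqF // ltn_eqF.
Qed.

Lemma gen_kderangements k :
  3 < n.+1 -> 0 < k < n.+1 -> <<kderangements k n.+1>> = [set: 'S_n.+1].
Proof.
move=> n3 kn; set D := kderangements k n.+1.
(* Take 2 if [k] is 1 or [n], which is safe because [n.+1 > 3], and 1 otherwise. *)
have [p p0 [kp knp]] : exists2 p : 'I_n.+1, p != ord0 & k != p /\ k != n.+1 - p.
  have [n1 n2] : 1 < n.+1 /\ 2 < n.+1 by lia.
  case: (boolP ((k == 1%N) || (k == n))) => k1.
    by exists (Ordinal n2) => //=; split; lia.
  by exists (Ordinal n1) => //=; split; lia.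
have D_split (q : 'I_n.+1) : k != q -> k != n.+1 - q -> split_rotation q \in <<D>>.
  by move=> kq knq; rewrite mem_gen // inE kderangement_split_rotation.
have tD : tperm ord0 p \in <<D>>.
  (* At [ord0] the transposition is trivial, so [split_rotation ord0] is the full cycle and
     cancels. *)
  have := groupM (groupVr (D_split ord0 _ _)) (D_split p kp knp).
  rewrite /split_rotation tperm1 mulg1 mulKg; apply => /=; lia.
have normD g : g \in 'N(<<D>>).
  apply: (subsetP (norm_gen _)); rewrite inE; apply/subsetP=> s.
  rewrite mem_conjg !inE => /(kderangementJ g).
  by rewrite conjgKV.
apply/eqP; rewrite eqEsubset subsetT -(gen_tperm (@ord0 n)) gen_subG.
apply/subsetP=> _ /imsetP[y _ ->].
have [->|y0] := eqVneq y ord0; first by rewrite tperm1.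
have -> : tperm ord0 y = tperm ord0 p ^ tperm p y.
  by rewrite tpermJ tpermL tpermD.
by rewrite memJ_norm.
Qed.

End Connectivity.

(** * Parity of the number of derangements of [k]-sets *)

Section Parity.
Variables k n : nat.
Implicit Type s : 'S_n.

Lemma fpf_involution_ord : ~~ odd n -> exists r : 'S_n, fpf_involution r.
Proof.
move=> even_n.
(* Swaps [2j] and [2j+1]; both lie below [n] since [n] is even. *)
pose f i := if odd i then i.-1 else i.+1.
have fn (i : 'I_n) : f i < n by have := ltn_ord i; rewrite /f; case: ifP; lia.
have fK : involutive (fun i => Ordinal (fn i)).
  by move=> i; apply: val_inj; rewrite /= /f; case: ifP; case: ifP; lia.
exists (perm (can_inj fK)); apply/fpf_involutionP; split=> i; rewrite !permE.
  exact: fK.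
by rewrite -val_eqE /= /f; case: ifP; lia.
Qed.

Lemma invg_fixedP s : reflect (involutive s) (s^-1 == s).
Proof.
apply: (iffP eqP) => [sV x | sK]; first by rewrite -{1}sV permK.
by apply/permP=> x; apply: (@perm_inj _ s); rewrite permKV sK.
Qed.

(** An invariant set of size [odd k], namely a fixed point or the empty set, is enlarged by the even
    number [k - odd k]. *)
Lemma kderangement_involutionN s :
    involutive s -> k <= n -> (exists x, s x == x) \/ ~~ odd k ->
  ~~ kderangement k s.
Proof.
move=> sK kn Hs; apply/kderangementP=> Ds.
have [A [cA sA]] : exists A : {set 'I_n}, #|A| = odd k /\ s @: A = A.
  case: (boolP (odd k)) Hs => [_ [[x /eqP sx] | ] | _ _] //.
    by exists [set x]; rewrite cards1 imset_set1 sx.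
  by exists set0; rewrite cards0 imset0.
have [||B cB sB] := @involution_invariant_set _ s A (k - odd k) sK sA.
- lia.
- by rewrite cA card_ord; lia.
by apply: (Ds B _ sB); rewrite cB cA; lia.
Qed.

Lemma odd_card_kderangements :
  0 < k < n -> odd #|kderangements k n| = odd k && ~~ odd n.
Proof.
case/andP=> k0 kn; rewrite (@odd_card_fixed _ _ (fun s => s^-1)); first last.
- by move=> s _; rewrite invgK.
- by move=> s; rewrite !inE; apply: kderangementV.
have [kodd|keven] /= := boolP (odd k && ~~ odd n).
  case/andP: kodd => oddk /fpf_involution_ord[r].
  move=> /odd_card_fpf_involutions; congr (odd _); apply: eq_card => s.
  rewrite !inE; apply/fpf_involutionP/andP => [[sK sx] | [Ds /invg_fixedP sK]].
    split; last exact/invg_fixedP.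
    apply/kderangementP=> A cA sA.
    (* On an invariant set of odd size, an involution has a fixed point by parity. *)
    have sAA : {in A, forall x, s x \in A} by move=> x xA; rewrite -sA imset_f.
    have := odd_card_fixed sAA (fun x _ => sK x); rewrite cA oddk.
    suff -> : [set x in A | s x == x] = set0 by rewrite cards0.
    by apply/setP=> x; rewrite !inE (negPf (sx x)) andbF.
  split=> // x; apply: contraL Ds => sx.
  by apply: kderangement_involutionN => //; [exact: ltnW | left; exists x].
rewrite (_ : [set s in _ | _] = set0) ?cards0 //; apply/setP=> s; rewrite !inE.
apply/andP=> -[Ds /invg_fixedP sK]; move: Ds; apply/negP.
apply: kderangement_involutionN => //; first exact: ltnW.
move: keven; rewrite negb_and negbK => /orP[|oddn]; [by right | left].
(* For odd [n], the same parity count on all points yields a fixed point. *)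
have := @odd_card_fixed _ [set: 'I_n] s; rewrite cardsT card_ord oddn.
move=> /(_ (fun x _ => in_setT _) (fun x _ => sK x))/esym.
case: (set_0Vmem [set x in [set: 'I_n] | s x == x]) => [->|[x]].
  by rewrite cards0.
by rewrite !inE => sx _; exists x.
Qed.

End Parity.

Theorem theorem2 (n k : nat) (hn : 3 < n) (hk1 : 1 <= k) (hkn : k < n) :
  eulerian (kderangement_graph k n) <-> ~~ odd k \/ (odd k /\ odd n).
Proof.
have deg u : odd (degree (kderangement_graph k n) u) = odd k && ~~ odd n.
  by rewrite degree_cayley_graph odd_card_kderangements // hk1.
have conn : connected_graph (kderangement_graph k n).
  case: n hn hkn {deg} => // n' hn hkn.
  by apply/connected_cayley_graph/gen_kderangements; rewrite ?hk1.
split=> [[_ /(_ 1)] | H]; first by rewrite deg; case: (odd k); case: (odd n); auto.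
by split=> // u; rewrite deg; case: (odd k) (odd n) H => [] [] // [|[]].
Qed.
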